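(* Let $A \in \mathbb{C}^{n\times n}$ have eigenvalue $\lambda = 0$, and let $s^{t_1}, \dots, s^{t_k}$, $t_1 \le \cdots \le t_k$, be the elementary divisors of $A$ corresponding to the eigenvalue $0$. Let $r = (r_1, \dots, r_k)$ be a $k$-tuple of integers with $0 \le r_i < t_i$ for $i = 1, \dots, k$. For a tuple of generators $U = (u_1, \dots, u_k)$ of $E_0(A) = \operatorname{Ker} A^n$ such that $\mathrm{e}(u_i) = t_i$, $i = 1,\dots,k$, and $E_0(A) = \langle u_1\rangle \oplus \cdots \oplus \langle u_k \rangle$, define $$W(r,U) = \langle A^{r_1}u_1\rangle \oplus \cdots \oplus \langle A^{r_k}u_k\rangle ,$$ and define $$W(r) = \bigl(\operatorname{Im} A^{r_1} \cap \operatorname{Ker} A^{t_1-r_1}\bigr) + \cdots + \bigl(\operatorname{Im} A^{r_k} \cap \operatorname{Ker} A^{t_k-r_k}\bigr).$$ Then the following statements are equivalent: (i) The $k$-tuple $r$ satisfies $r_1 \le \cdots \le r_k$ and $t_1 - r_1 \le \cdots \le t_k - r_k$. (ii) The space $W(r,U)$ is independent of $U$, i.e. $W(r,U) = W(r,\tilde U)$ for any two tuples of generators $U = (u_1,\dots,u_k)$, $\tilde U = (\tilde u_1,\dots,\tilde u_k)$ of $E_0(A)$ with $\mathrm{e}(u_i) = \mathrm{e}(\tilde u_i) = t_i$, $i = 1,\dots,k$, and $E_0(A) = \langle u_1\rangle \oplus \cdots \oplus \langle u_k \rangle = \langle \tilde u_1\rangle \oplus \cdots \oplus \langle \tilde u_k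 \rangle$. Moreover, if $r_1 \le \cdots \le r_k$ and $t_1 - r_1 \le \cdots \le t_k - r_k$ hold, then $W(r,U) = W(r)$ for every such $U$.
   Context: For $A \in \mathbb{C}^{n\times n}$, $E_0(A) = \operatorname{Ker} A^n$ is the generalized eigenspace of $A$ for the eigenvalue $0$. For $v \in E_0(A)$, $\langle v\rangle = \operatorname{span}\{A^\nu v : \nu \ge 0\}$ is the cyclic subspace generated by $v$. For nonzero $v \in E_0(A)$, the exponent $\mathrm{e}(v)$ is the integer $p \geq 1$ with $v \in \operatorname{Ker} A^p$ and $v \notin \operatorname{Ker} A^{p-1}$; thus $\dim\langle v\rangle = \mathrm{e}(v)$. If $s^{t_1},\dots,s^{t_k}$ with $t_1\le\cdots\le t_k$ are the elementary divisors of $A$ corresponding to $0$ (the sizes of the Jordan blocks for $0$ being $t_1,\dots,t_k$), a tuple of generators of $E_0(A)$ is a $k$-tuple $U = (u_1,\dots,u_k)$ of vectors of $E_0(A)$ with $\mathrm{e}(u_i) = t_i$ for all $i$ and $E_0(A) = \langle u_1\rangle\oplus\cdots\oplus\langle u_k\rangle$. *)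

(* Defs.v *)
From HB Require Import structures.
From mathcomp Require Import all_boot all_order all_algebra.
From mathcomp Require Export reals.
From mathcomp.real_closed Require Export complex.

Set Implicit Arguments.
Unset Strict Implicit.
Unset Printing Implicit Defensive.

Import GRing.Theory.

Local Open Scope ring_scope.

Section Defs.
Variables (F : fieldType) (n : nat).
Implicit Types (A : 'M[F]_n) (v : 'cV[F]_n) (k p : nat).

Definition mxKer A p : {vspace 'cV[F]_n} := lker (linfun (mulmx (A ^+ p))).

Definition mxIm A p : {vspace 'cV[F]_n} := limg (linfun (mulmx (A ^+ p))).

Definition E0 A : {vspace 'cV[F]_n} := mxKer A n.

Lemma mem_mxKer A p v : (v \in mxKer A p) = (A ^+ p *m v == 0).
Proof. by rewrite memv_ker lfunE. Qed.

(* The powers below [n] suffice by Cayley-Hamilton: see [mem_cyclic_space]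
   and [cyclic_space_min]. *)
Definition cyclic_space A v : {vspace 'cV[F]_n} :=
  <<[seq A ^+ i *m v | i <- iota 0 n]>>%VS.

End Defs.

Lemma mem_cyclic_space (F : fieldType) n (A : 'M[F]_n) (v : 'cV[F]_n) nu :
  A ^+ nu *m v \in cyclic_space A v.
Proof.
have memlt i : (i < n)%N -> A ^+ i *m v \in cyclic_space A v.
  by move=> lt_in; apply: memv_span; apply: map_f; rewrite mem_iota.
case: n A v memlt => [|m] A v memlt.
  by rewrite (flatmx0 (_ *m v)) mem0v.
have memP (q : {poly F}) : (size q <= m.+1)%N ->
    horner_mx A q *m v \in cyclic_space A v.
  move=> sz_q; rewrite -[q]coefK poly_def rmorph_sum mulmx_suml /=.
  apply: memv_suml => i _.
  rewrite linearZ /= rmorphXn /= horner_mx_X -scalemxAl memvZ // memlt //.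
  exact: leq_trans sz_q.
have -> : A ^+ nu = horner_mx A ('X^nu %% char_poly A).
  have := congr1 (horner_mx A) (divp_eq 'X^nu (char_poly A)).
  by rewrite rmorphD rmorphM /= Cayley_Hamilton mulr0 add0r rmorphXn /= horner_mx_X.
apply: memP; rewrite -ltnS -(size_char_poly A) ltn_modp.
exact: monic_neq0 (char_poly_monic A).
Qed.

Section Generators.
Variables (F : fieldType) (n : nat).
Implicit Types (A : 'M[F]_n) (v : 'cV[F]_n) (k p : nat).

Lemma cyclic_space_min A v (S : {vspace 'cV[F]_n}) :
  (forall nu, A ^+ nu *m v \in S) -> (cyclic_space A v <= S)%VS.
Proof. by move=> memS; apply/span_subvP => _ /mapP[i _ ->]. Qed.

Definition has_exponent A v p : bool :=
  [&& (0 < p)%N, v \in mxKer A p & v \notin mxKer A p.-1].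

Definition jordan_block (p : nat) (a : F) : 'M[F]_p :=
  \matrix_(i, j) (if i == j then a else if j == i.+1 :> nat then 1 else 0).

(* [P] and [Q] are mutually inverse changes of basis, which forces
   [n = \sum_i s i]; this avoids casting between the two dimensions. *)
Definition jordan_form A m (s : 'I_m -> nat) (a : 'I_m -> F) : Prop :=
  (forall i, 0 < s i)%N /\
  exists (P : 'M[F]_(n, \sum_i s i)) (Q : 'M[F]_(\sum_i s i, n)),
    [/\ P *m Q = 1%:M, Q *m P = 1%:M
      & A = P *m (\mxdiag_i jordan_block (s i) (a i)) *m Q].

(* The elementary divisors of [A] for the eigenvalue [b] are the
   [('X - b%:P) ^+ t i], with multiplicity and up to order: the [t i] are the
   sizes of the Jordan blocks with eigenvalue [b]. *)
Definition elementary_divisors A (b : F) k (t : 'I_k -> nat) : Prop :=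
  exists m (s : 'I_m -> nat) (a : 'I_m -> F),
    jordan_form A s a /\
    perm_eq [seq t i | i <- enum 'I_k]
            [seq s j | j <- enum 'I_m & a j == b].

Definition generators A k (t : 'I_k -> nat) (u : 'I_k -> 'cV[F]_n) : Prop :=
  [/\ forall i, u i \in E0 A,
      forall i, has_exponent A (u i) (t i),
      (\sum_i cyclic_space A (u i))%VS = E0 A
    & directv (\sum_i cyclic_space A (u i))].

Definition WU A k (r : 'I_k -> nat) (u : 'I_k -> 'cV[F]_n) :
    {vspace 'cV[F]_n} :=
  (\sum_i cyclic_space A (A ^+ r i *m u i))%VS.

(* The sum defining [WU] is direct, as in [W(r,U)]. *)
Lemma WU_direct A k (t r : 'I_k -> nat) (u : 'I_k -> 'cV[F]_n) :
  generators A t u -> directv (\sum_i cyclic_space A (A ^+ r i *m u i)).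
Proof.
case=> _ _ _ dirU; apply/directv_sum_independent => w memw.
apply: (elimT directv_sum_independent dirU) => i _.
apply: subvP (memw i isT); apply: cyclic_space_min => nu.
by rewrite mulmxA mulmxE -exprD mem_cyclic_space.
Qed.

(* Meant for [r i < t i], so that [t i - r i] is an honest difference. *)
Definition W A k (t r : 'I_k -> nat) : {vspace 'cV[F]_n} :=
  (\sum_i (mxIm A (r i) :&: mxKer A (t i - r i)))%VS.

End Generators.

(* Main.v *)
(** Write [x = sum_j p_j(A) u_j] for [x] in [Ker A^t_i]. Since the sum of the
    [<u_j>] is direct, [s^(t_j - t_i)] divides [p_j] when [t_j >= t_i], so the
    two monotonicity conditions put the components of [A^r_i x] in the
    [<A^r_j u_j>]; hence [W(r) = W(r,U)].

    Conversely, for [i != j] and [t_j <= d + t_i], replacing [u_i] by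
    [u_i + A^d u_j] gives another tuple of generators. If [W(r,U)] does not
    change, it contains [A^(r_i + d) u_j], which forces [r_j <= r_i + d]. The
    choices [d = 0] (for [t_j <= t_i]) and [d = t_j - t_i] (for [t_i <= t_j])
    give the two conditions. A tuple [U] to start from is read off the Jordan
    form: take the last basis vector of each nilpotent block. *)

Require Import Defs.
From mathcomp Require Import all_boot all_order all_algebra.
From mathcomp Require Import zify.

Set Implicit Arguments.
Unset Strict Implicit.
Unset Printing Implicit Defensive.

Local Open Scope ring_scope.

Import GRing.Theory.

(** * Cyclic subspaces as modules over polynomials, and annihilators *)

Section Nilpotent.
Variables (F : fieldType) (n' : nat).
Local Notation n := n'.+1.
Implicit Types (A : 'M[F]_n) (u v w : 'cV[F]_n) (p q : {poly F}).

Lemma horner_mxXnM A d q : horner_mx A ('X^d * q) = A ^+ d * horner_mx A q.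
Proof. by rewrite rmorphM rmorphXn /= horner_mx_X. Qed.

Lemma horner_mxXn A d : horner_mx A 'X^d = A ^+ d.
Proof. by rewrite rmorphXn /= horner_mx_X. Qed.

Lemma expmx_hornerC A d p v :
  A ^+ d *m (horner_mx A p *m v) = horner_mx A p *m (A ^+ d *m v).
Proof. by rewrite -horner_mxXn !mulmxA mulmxE -!rmorphM mulrC. Qed.

(** Identifies [cyclic_space A v] with the cyclic module over [{poly F}] generated by [v], so that
    membership becomes divisibility of polynomials. *)
Lemma cyclic_spaceP A v w :
  reflect (exists p, w = horner_mx A p *m v) (w \in cyclic_space A v).
Proof.
apply: (iffP idP) => [|[p ->]].
  rewrite /cyclic_space; set s := [seq _ | i <- _].
  have size_s : size s = n by rewrite size_map size_iota.
  move/(coord_span (X := in_tuple s)) => {1}->.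
  exists (\sum_(i < size s) coord (in_tuple s) i w *: 'X^i).
  rewrite rmorph_sum mulmx_suml; apply: eq_bigr => i _ /=.
  rewrite linearZ /= horner_mxXn -scalemxAl /s (nth_map 0%N) ?nth_iota //.
    by have := ltn_ord i; rewrite [X in (_ < X)%N]size_s.
  by have := ltn_ord i; rewrite [X in (_ < X)%N]size_s size_iota.
rewrite -[p]coefK poly_def rmorph_sum mulmx_suml /=; apply: memv_suml => i _.
by rewrite linearZ /= horner_mxXn -scalemxAl memvZ ?mem_cyclic_space.
Qed.

Lemma horner_mx_mem A p v w :
  w \in cyclic_space A v -> horner_mx A p *m w \in cyclic_space A v.
Proof.
case/cyclic_spaceP => q ->; apply/cyclic_spaceP; exists (p * q).
by rewrite mulmxA mulmxE rmorphM.
Qed.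

Lemma expmx_mem A d v w :
  w \in cyclic_space A v -> A ^+ d *m w \in cyclic_space A v.
Proof. by move=> ?; rewrite -horner_mxXn horner_mx_mem. Qed.

Lemma cyclic_space_sub A v w :
  w \in cyclic_space A v -> (cyclic_space A w <= cyclic_space A v)%VS.
Proof. by move=> wv; apply: cyclic_space_min => nu; apply: expmx_mem. Qed.

Lemma cyclic_space_id A v : v \in cyclic_space A v.
Proof. by have := mem_cyclic_space A v 0; rewrite expr0 mul1mx. Qed.

Lemma expmx_cyclic_eq0 A d v w :
  A ^+ d *m v = 0 -> w \in cyclic_space A v -> A ^+ d *m w = 0.
Proof.
move=> Av0 /cyclic_spaceP[p ->].
by rewrite expmx_hornerC Av0 mulmx0.
Qed.

Lemma expmx_eq0_leq A d e v : (d <= e)%N -> A ^+ d *m v = 0 -> A ^+ e *m v = 0.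
Proof.
by move=> /subnK <- Av0; rewrite exprD -mulmxE -mulmxA Av0 mulmx0.
Qed.

Lemma has_exponentP A v d :
  reflect [/\ (0 < d)%N, A ^+ d *m v = 0 & A ^+ d.-1 *m v <> 0]
          (has_exponent A v d).
Proof.
rewrite /has_exponent !mem_mxKer.
apply: (iffP and3P) => [[-> /eqP-> /eqP]|[-> -> /eqP]] //.
Qed.

Lemma has_exponent_leq A v d e :
  has_exponent A v d -> A ^+ e *m v = 0 -> (d <= e)%N.
Proof.
case/has_exponentP => d0 _ nz Ae0; rewrite leqNgt; apply/negP => ltd.
by apply: nz; apply: expmx_eq0_leq Ae0; lia.
Qed.

(** As [q] is coprime to ['X^d], a Bezout relation writes 1 as a combination of two polynomials that
    both annihilate [v]. *)
Lemma horner_mx_nil_inj A q d v :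
  ~~ root q 0 -> A ^+ d *m v = 0 -> horner_mx A q *m v = 0 -> v = 0.
Proof.
rewrite -coprimepX => /(coprimep_expr d)/Bezout_eq1_coprimepP[[a b] /= ab1].
move=> Ad0 Aq0; have <- : horner_mx A 1 *m v = v by rewrite rmorph1 mul1mx.
rewrite -ab1 rmorphD !rmorphM /= horner_mxXn mulmxDl -!mulmxE -!mulmxA Ad0 Aq0.
by rewrite !mulmx0 addr0.
Qed.

(** Factor [p] as [q * 'X^e] with [q] nonzero at 0. By [horner_mx_nil_inj] the factor [q] can be
    cancelled, so [A ^+ e] already kills [v] and [d <= e]. *)
Lemma dvdp_annihilator A v d p :
  has_exponent A v d -> horner_mx A p *m v = 0 -> 'X^d %| p.
Proof.
move=> ev Ap0; have [->|nzp] := eqVneq p 0; first exact: dvdp0.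
have [e [q]] := multiplicity_XsubC p 0; rewrite nzp subr0 /= => q0 defp.
rewrite defp dvdp_mull ?dvdp_exp2l //; apply: (has_exponent_leq ev).
have [_ Ad0 _] := has_exponentP _ _ _ ev.
apply: (horner_mx_nil_inj (A := A) q0 (d := d)).
  by rewrite mulmxA mulmxE -exprD; apply: expmx_eq0_leq Ad0; lia.
by rewrite -horner_mxXn mulmxA mulmxE -rmorphM -defp.
Qed.

(** If [w] is [p] applied to [v], then ['X^d] divides ['X^e * p]; cancelling ['X^e] leaves a factor
    ['X^(d - e)] in [p]. *)
Lemma mem_cyclic_space_ker A v w d e :
    has_exponent A v d -> (e <= d)%N -> w \in cyclic_space A v ->
    A ^+ e *m w = 0 ->
  w \in cyclic_space A (A ^+ (d - e) *m v).
Proof.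
move=> ev le_ed /cyclic_spaceP[p ->].
rewrite mulmxA mulmxE -horner_mxXnM => /(dvdp_annihilator ev).
rewrite -{1}(subnKC le_ed) exprD dvdp_mul2l ?expf_neq0 ?polyX_eq0 //.
case/dvdpP => q ->; apply/cyclic_spaceP; exists q.
by rewrite rmorphM /= horner_mxXn -mulmxE mulmxA.
Qed.

(** * Comparison of [WU] with [W] *)

Section Generators.
Variables (A : 'M[F]_n) (k : nat) (t : 'I_k -> nat).
Implicit Types (r : 'I_k -> nat) (x y : 'I_k -> 'cV[F]_n).

Lemma generators_uniq U x y :
    generators A t U ->
    (forall i, x i \in cyclic_space A (U i)) ->
    (forall i, y i \in cyclic_space A (U i)) ->
    \sum_i x i = \sum_i y i ->
  x =1 y.
Proof.
case=> _ _ _ /directv_sum_unique dirU xU yU /eqP.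
rewrite (dirU x y (fun i _ => xU i) (fun i _ => yU i)) => /forall_inP xy i.
exact/eqP/xy.
Qed.

Lemma WU_sub_W r U : generators A t U -> (WU A r U <= W A t r)%VS.
Proof.
case=> _ eU _ _; apply/subv_sumP => i _; apply: (sumv_sup i) => //.
have [_ Ati _] := has_exponentP _ _ _ (eU i).
apply: cyclic_space_min => nu; rewrite memv_cap mem_mxKer !mulmxA !mulmxE -!exprD.
apply/andP; split.
  apply/memv_imgP; exists (A ^+ nu *m U i); rewrite ?memvf //.
  by rewrite lfunE /= mulmxA mulmxE -exprD addnC.
by apply/eqP; apply: expmx_eq0_leq Ati; lia.
Qed.

Lemma W_sub_WU r U :
    {homo t : i j / (i <= j)%N} -> (forall i, r i < t i)%N ->
    {homo r : i j / (i <= j)%N} ->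
    {homo (fun i => t i - r i)%N : i j / (i <= j)%N} ->
  generators A t U -> (W A t r <= WU A r U)%VS.
Proof.
move=> tS rt rS trS genU; have [_ eU sumU _] := genU.
apply/subv_sumP => i _; apply/subvP => w.
rewrite memv_cap mem_mxKer => /andP[/memv_imgP[x _ ->]].
rewrite lfunE /= mulmxA mulmxE -exprD subnK 1?ltnW // => /eqP Ax0.
have : x \in E0 A.
  rewrite mem_mxKer; apply/eqP; apply: expmx_eq0_leq Ax0.
  (* [A ^+ n] kills [U i], whose exponent is [t i]; hence [t i <= n]. *)
  case: genU => /(_ i) + _ _ _; rewrite mem_mxKer => /eqP.
  exact: has_exponent_leq (eU i).
rewrite -sumU => /memv_sumP[y yU def_x].
have {}yU j : y j \in cyclic_space A (U j) by apply: yU.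
have y0 j : A ^+ t i *m y j = 0.
  apply: (generators_uniq (y := fun=> 0) genU (x := fun j => A ^+ t i *m y j)).
  - by move=> l; apply: expmx_mem.
  - by move=> l; apply: mem0v.
  - by rewrite -mulmx_sumr -def_x Ax0 big1.
rewrite def_x mulmx_sumr; apply: memv_suml => j _.
apply: (subvP (sumv_sup j _ (subvv _))) => //.
(* For [j <= i] the bound [r j <= r i] suffices. For [i < j], [y j] is killed by [A ^+ t i], which
   gives it an extra factor [A ^+ (t j - t i)]. *)
have [le_ji|lt_ij] := leqP j i.
  have /cyclic_spaceP[p ->] := yU j.
  rewrite -(subnK (rS _ _ le_ji)) exprD -mulmxE -mulmxA expmx_hornerC.
  by rewrite expmx_mem ?horner_mx_mem ?cyclic_space_id.
have le_t := tS _ _ (ltnW lt_ij); have le_tr := trS _ _ (ltnW lt_ij).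
have := mem_cyclic_space_ker (eU j) le_t (yU j) (y0 j).
case/cyclic_spaceP => p ->.
rewrite expmx_hornerC horner_mx_mem // mulmxA mulmxE -exprD.
(* The outer subtraction is not truncated: [r j <= r i + (t j - t i)] is the monotonicity of
   [t - r]. *)
have -> : (r i + (t j - t i) = (r i + (t j - t i) - r j) + r j)%N.
  by have := rt i; have := rt j; move: le_tr => /=; lia.
by rewrite exprD -mulmxE -mulmxA mem_cyclic_space.
Qed.

(** * Changing one generator by a multiple of another *)

Definition transvect U i j d : 'I_k -> 'cV[F]_n :=
  fun l => if l == i then U i + A ^+ d *m U j else U l.

(** The bound on [t j] makes [A ^+ t i] kill the added vector, so the exponent does not grow. It
    does not drop either, and the sum stays direct, because the added vector has no component in the
    cyclic space of [U i]. *)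
Lemma transvect_generators U i j d :
    i != j -> (t j <= d + t i)%N ->
  generators A t U -> generators A t (transvect U i j d).
Proof.
move=> ne_ij le_t genU; have [UE eU sumU dirU] := genU.
pose V := transvect U i j d.
have Vi : V i = U i + A ^+ d *m U j by rewrite /V /transvect eqxx.
have Vl l : l != i -> V l = U l by rewrite /V /transvect => /negPf->.
have ne_ji : j != i by rewrite eq_sym.
have VE l : V l \in E0 A.
  have [->|/Vl->//] := eqVneq l i; rewrite Vi memvD // mem_mxKer.
  have := UE j; rewrite mem_mxKer => /eqP Aj0.
  by rewrite mulmxA mulmxE -exprD; apply/eqP; apply: expmx_eq0_leq Aj0; lia.
have [_ Ai0 Ai1] := has_exponentP _ _ _ (eU i).
have [_ Aj0 _] := has_exponentP _ _ _ (eU j).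
have AtUj : A ^+ t i *m (A ^+ d *m U j) = 0.
  by rewrite mulmxA mulmxE -exprD; apply: expmx_eq0_leq Aj0; lia.
(* The component in [<U i>] of the relation, as the added term lies in [<U j>]. *)
have decomp p (w : 'I_k -> 'cV[F]_n) :
    (forall l, l != i -> w l \in cyclic_space A (U l)) ->
    horner_mx A p *m V i + \sum_(l | l != i) w l = 0 ->
    horner_mx A p *m U i = 0.
  move=> wU sum0.
  (* The relation regrouped along the original decomposition: the part coming from the added vector
     moves to index [j]. *)
  pose x l := if l == i then horner_mx A p *m U i else
    if l == j then w l + horner_mx A p *m (A ^+ d *m U j) else w l.
  have := @generators_uniq U x (fun=> 0) genU _ _ _ i; rewrite /x eqxx.
  apply.
  - move=> l; case: eqVneq => [->|nei]; first by rewrite horner_mx_mem ?cyclic_space_id.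
    case: eqVneq => [->|nej]; last exact: wU.
    by rewrite memvD ?wU // horner_mx_mem ?mem_cyclic_space.
  - by move=> l; apply: mem0v.
  rewrite [RHS]big1 // -[RHS]sum0 (bigD1 i) //= eqxx Vi mulmxDr -addrA.
  congr (_ + _); rewrite !(bigD1 j ne_ji) /= (negPf ne_ji) eqxx addrA.
  rewrite [w j + _]addrC; congr (_ + _ + _).
  by apply: eq_bigr => l /andP[/negPf-> /negPf->].
have eV l : has_exponent A (V l) (t l).
  have [->|/Vl->//] := eqVneq l i; apply/has_exponentP; split.
  - by have [] := has_exponentP _ _ _ (eU i).
  - by rewrite Vi mulmxDr Ai0 AtUj addr0.
  move=> AV0; apply: Ai1; rewrite -horner_mxXn; apply: (decomp _ (fun=> 0)).
    by move=> *; apply: mem0v.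
  by rewrite horner_mxXn AV0 big1 ?addr0.
split=> //.
  apply/eqP; rewrite eqEsubv; apply/andP; split.
    apply/subv_sumP => l _; apply: cyclic_space_min => nu.
    have := VE l; rewrite !mem_mxKer => /eqP Al0; apply/eqP.
    exact: expmx_cyclic_eq0 Al0 (mem_cyclic_space _ _ _).
  have subV l : (cyclic_space A (V l) <= \sum_i cyclic_space A (V i))%VS.
    exact: (sumv_sup l).
  rewrite -sumU; apply/subv_sumP => l _.
  have [->|/Vl<-] := eqVneq l i; last exact: subV.
  apply: cyclic_space_min => nu.
  have -> : U i = V i - A ^+ d *m V j by rewrite Vi (Vl _ ne_ji) addrK.
  rewrite mulmxBr memvB //.
    by apply: (subvP (subV i)); apply: mem_cyclic_space.
  by apply: (subvP (subV j)); rewrite expmx_mem ?mem_cyclic_space.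
apply/directv_sum_independent => w wV sum0.
have {}wV l : w l \in cyclic_space A (V l) by apply: wV.
(* If [w i] is [p] applied to [V i], then [p] annihilates [U i], so ['X^(t i)] divides [p] and [p]
   annihilates [V i] too. The remaining terms form a relation among the original generators. *)
have wi0 : w i = 0.
  have /cyclic_spaceP[p def_wi] := wV i.
  have /(dvdp_annihilator (eU i))/dvdpP[q def_p] : horner_mx A p *m U i = 0.
    apply: (decomp _ w); first by move=> l /Vl <-.
    by rewrite -def_wi -[RHS]sum0 [RHS](bigD1 i).
  have [_ AVi _] := has_exponentP _ _ _ (eV i).
  by rewrite def_wi def_p rmorphM /= horner_mxXn -mulmxE -mulmxA AVi mulmx0.
move=> l _; have := @generators_uniq U w (fun=> 0) genU; apply.
- move=> m; have [->|/Vl<-//] := eqVneq m i; rewrite wi0; exact: mem0v.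
- by move=> m; apply: mem0v.
by rewrite sum0 big1.
Qed.

(** By invariance [A ^+ (r i + d) *m U j] lies in [WU A r U]. It equals its own component at index
    [j], which [A ^+ (t j - r j)] kills; comparing with the exponent [t j] of [U j] gives the
    bound. *)
Lemma WU_invariant_leq r U i j d :
    generators A t U -> (r j < t j)%N ->
    i != j -> (t j <= d + t i)%N ->
    WU A r U = WU A r (transvect U i j d) ->
  (r j <= r i + d)%N.
Proof.
move=> genU rtj ne_ij le_t eqW; have [_ eU _ _] := genU.
have: A ^+ (r i + d) *m U j \in WU A r U.
  have -> : A ^+ (r i + d) *m U j =
            A ^+ r i *m transvect U i j d i - A ^+ r i *m U i.
    by rewrite /transvect eqxx mulmxDr addrC addKr mulmxA mulmxE -exprD.
  apply: memvB; last first.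
    by apply: (subvP (sumv_sup i _ (subvv _))); rewrite ?cyclic_space_id.
  by rewrite eqW; apply: (subvP (sumv_sup i _ (subvv _))); rewrite ?cyclic_space_id.
case/memv_sumP => w wU def_w.
have {}wU l : w l \in cyclic_space A (A ^+ r l *m U l) by apply: wU.
have wj : A ^+ (r i + d) *m U j = w j.
  pose x l := if l == j then A ^+ (r i + d) *m U j else 0.
  have := @generators_uniq U x w genU _ _ _ j; rewrite /x eqxx; apply.
  - by move=> l; case: eqVneq => [->|_]; rewrite ?mem0v ?mem_cyclic_space.
  - move=> l; apply: subvP (wU l); apply: cyclic_space_sub.
    exact: mem_cyclic_space.
  - by rewrite -big_mkcond big_pred1_eq.
have [_ Atj _] := has_exponentP _ _ _ (eU j).
have : A ^+ (t j - r j) *m w j = 0.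
  apply: expmx_cyclic_eq0 (wU j).
  by rewrite mulmxA mulmxE -exprD; apply: expmx_eq0_leq Atj; lia.
rewrite -wj mulmxA mulmxE -exprD => /(has_exponent_leq (eU j)); lia.
Qed.

End Generators.

End Nilpotent.

(** * Generators from the Jordan form *)

Section Jordan.
Variable F : fieldType.

Lemma jordan_block_unit p (a : F) : a != 0 -> jordan_block p a \in unitmx.
Proof.
(* [det_trig] concerns lower triangular matrices, while Jordan blocks here are upper triangular;
   hence the transpose. *)
move=> a0; rewrite unitmxE -det_tr det_trig; last first.
  apply/is_trig_mxP => i j lt_ij; rewrite !mxE -!val_eqE /=.
  by rewrite !ifF //; apply/eqP; lia.
by rewrite unitfE; apply/prodf_neq0 => i _; rewrite !mxE eqxx.
Qed.

(** The block shifts each basis vector to the preceding one. Encoding the vectors by a test on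
    indices also covers [p <= d], where the test always fails and the column is zero. *)
Lemma jordan_block0_exp_last p d :
  jordan_block p (0 : F) ^+ d *m (\col_i (i.+1 == p)%:R) =
  \col_i ((i + d).+1 == p)%:R.
Proof.
elim: d => [|d IHd].
  by rewrite expr0 mul1mx; apply/colP => i; rewrite !mxE addn0.
rewrite exprS -mulmxE -mulmxA IHd; apply/colP => i; rewrite !mxE.
have [lt_ip|le_pi] := ltnP i.+1 p.
  rewrite (bigD1 (Ordinal lt_ip)) //= big1 => [|j ne_j].
    rewrite !mxE -val_eqE /= eqxx ifF ?mul1r ?addr0; first by rewrite addSnnS.
    by apply/eqP; lia.
  rewrite !mxE; case: ifP => _; rewrite ?mul0r //.
  by move: ne_j; rewrite -val_eqE /= => /negPf->; rewrite mul0r.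
rewrite big1 => [|j _].
  by case: eqP => //; lia.
rewrite !mxE; case: ifP => _; rewrite ?mul0r //.
by case: eqP => e; rewrite ?mul0r //; have := ltn_ord j; lia.
Qed.

Lemma perm_eq_map_lift (T1 T2 : eqType) (g : T1 -> T2) s1 s2 :
    perm_eq s1 (map g s2) ->
  exists2 s3, perm_eq s3 s2 & s1 = map g s3.
Proof.
case: s2 => [|x s2]; first by move/perm_nilP->; exists [::].
move: (x :: s2) => {}s2 /(perm_iotaP (g x))[I]; rewrite size_map => permI ->.
exists (map (nth x s2) I).
  by apply: perm_trans (perm_map _ permI) _; rewrite map_nth_iota0 ?take_size.
rewrite -map_comp; apply/eq_in_map => i.
by rewrite (perm_mem permI) mem_iota => /andP[_ lt_i]; rewrite /= (nth_map x).
Qed.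

(** Turns an equality of multisets of block sizes into an explicit numbering [f] of the selected
    blocks, from which generators can be indexed. *)
Lemma perm_eq_enum_lift (T : eqType) k m (t : 'I_k -> T) (s : 'I_m -> T)
    (S : pred 'I_m) :
    perm_eq [seq t i | i <- enum 'I_k] [seq s j | j <- enum 'I_m & S j] ->
  exists2 f : 'I_k -> 'I_m, forall i, t i = s (f i)
    & perm_eq [seq f i | i <- enum 'I_k] [seq j <- enum 'I_m | S j].
Proof.
case/perm_eq_map_lift => e perm_e eq_ts.
have size_e : size e = k.
  by have := congr1 size eq_ts; rewrite size_map size_enum_ord size_map.
have f_e : [seq tnth (in_tuple e) (cast_ord (esym size_e) i) | i <- enum 'I_k] = e.
  case: _ / size_e {t eq_ts} => {perm_e}; rewrite -[RHS](map_tnth_enum (in_tuple e)) /=.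
  by apply: eq_map => i; rewrite cast_ord_id.
move: (fun i => _) f_e => f f_e; exists f; last by rewrite f_e.
move=> i; move: eq_ts; rewrite -f_e -map_comp => /eq_in_map-> //.
by rewrite mem_enum.
Qed.

Lemma submxblock1_diag m (s : 'I_m -> nat) j :
  submxblock (1%:M : 'M[F]_(\sum_i s i)) j j = 1%:M.
Proof. by rewrite -mxdiagZ submxblock_diag. Qed.

Lemma submxblock1_neq m (s : 'I_m -> nat) i j :
  i != j -> submxblock (1%:M : 'M[F]_(\sum_i s i)) i j = 0.
Proof.
by move=> /negPf ne_ij; rewrite -mxdiagZ /mxdiag mxblockK ne_ij.
Qed.

Lemma exists_generators n' (A : 'M[F]_n'.+1) k (t : 'I_k -> nat) :
  elementary_divisors A 0 t -> exists U, generators A t U.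
Proof.
move=> [m [s [a [[s0 [P [Q [PQ QP defA]]]] /perm_eq_enum_lift[f tf permf]]]]].
(* [B j] embeds the space of the [j]-th block and [C j] is the coordinate projection onto it. *)
pose B j := submxrow P j; pose C j := submxcol Q j.
pose J j := jordan_block (s j) (a j).
have BC : \sum_j B j *m C j = 1%:M.
  by rewrite -PQ -[P]submxrowK -[Q]submxcolK mul_mxrow_mxcol.
have CB i j : C i *m B j = submxblock 1%:M i j.
  by rewrite -QP -[P]submxrowK -[Q]submxcolK mul_mxcol_mxrow mxblockK.
have AB j : A *m B j = B j *m J j.
  have : A *m P = P *m \mxdiag_i J i by rewrite defA -mulmxA QP mulmx1.
  rewrite -[P]submxrowK mul_mxrow_mxdiag mul_mxrow => /(congr1 (fun M => submxrow M j)).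
  by rewrite !mxrowK.
have CA j : C j *m A = J j *m C j.
  have : Q *m A = (\mxdiag_i J i) *m Q by rewrite defA !mulmxA QP mul1mx.
  rewrite -[Q]submxcolK mul_mxdiag_mxcol mxcol_mul => /(congr1 (fun M => submxcol M j)).
  by rewrite !mxcolK.
have AXB d j : A ^+ d *m B j = B j *m J j ^+ d.
  elim: d => [|d IHd]; first by rewrite !expr0 mul1mx mulmx1.
  by rewrite !exprS -!mulmxE -mulmxA IHd !mulmxA AB.
have CAX d j : C j *m A ^+ d = J j ^+ d *m C j.
  elim: d => [|d IHd]; first by rewrite !expr0 mul1mx mulmx1.
  by rewrite !exprSr -!mulmxE mulmxA IHd -!mulmxA CA.
have af i : a (f i) = 0.
  have : f i \in [seq j <- enum 'I_m | a j == 0].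
    by rewrite -(perm_mem permf) map_f ?mem_enum.
  by rewrite mem_filter => /andP[/eqP].
have f_inj : injective f.
  apply/injectiveP; rewrite /injectiveb /dinjectiveb (perm_uniq permf).
  by rewrite filter_uniq ?enum_uniq.
(* The basis vector [d] places before the last one, or 0 once [s j <= d]. *)
pose e d j : 'cV[F]_(s j) := \col_c ((c + d).+1 == s j)%:R.
pose U i := B (f i) *m e 0%N (f i).
have AXU d i : A ^+ d *m U i = B (f i) *m e d (f i).
  rewrite /U mulmxA AXB -mulmxA /J af.
  have -> : e 0%N (f i) = \col_c (c.+1 == s (f i))%:R.
    by apply/colP => c; rewrite !mxE addn0.
  by rewrite jordan_block0_exp_last.
have e0 d j : (s j <= d)%N -> e d j = 0.
  by move=> le_d; apply/colP => c; rewrite !mxE; case: eqP => //; lia.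
(* [B j] has a left inverse; the bound then ensures that [A ^+ n] kills every [U i]. *)
have le_sn j : (s j <= n'.+1)%N.
  by apply: (@mulmx1_min _ _ _ (C j) (B j)); rewrite CB submxblock1_diag.
have BU i (y : 'cV[F]_(s (f i))) : B (f i) *m y \in cyclic_space A (U i).
  have -> : y = \sum_c y c 0 *: e (s (f i) - c.+1)%N (f i).
    apply/colP => c; rewrite summxE (bigD1 c) //= !mxE big1 => [|d ne_d].
      by rewrite (_ : _ == _) ?mulr1 ?addr0 //; apply/eqP; have := ltn_ord c; lia.
    rewrite !mxE; case: eqP => [eq_cd|]; rewrite ?mulr0 //; case/eqP: ne_d.
    by apply: val_inj; have := ltn_ord c; have := ltn_ord d; move=> /=; lia.
  rewrite mulmx_sumr; apply: memv_suml => c _.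
  by rewrite -scalemxAr memvZ // -AXU mem_cyclic_space.
have cycU i w : w \in cyclic_space A (U i) -> exists y, w = B (f i) *m y.
  case/cyclic_spaceP => p ->.
  exists (\sum_(d < size p) p`_d *: e d (f i)).
  rewrite -[p]coefK poly_def rmorph_sum mulmx_suml mulmx_sumr /=.
  rewrite -poly_def coefK; apply: eq_bigr => d _.
  by rewrite linearZ /= horner_mxXn -scalemxAl AXU scalemxAr.
have C_B_inj j (y : 'cV[F]_(s j)) : C j *m (B j *m y) = y.
  by rewrite mulmxA CB submxblock1_diag mul1mx.
have UE i : U i \in E0 A.
  by rewrite mem_mxKer AXU e0 ?mulmx0 ?eqxx.
exists U; split=> //.
- move=> i; apply/has_exponentP; rewrite tf; split=> //.
    by rewrite AXU e0 ?mulmx0.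
  rewrite AXU => /(congr1 (mulmx (C (f i)))); rewrite C_B_inj mulmx0.
  move/colP/(_ (Ordinal (s0 (f i)))); rewrite !mxE /= add0n prednK // eqxx.
  by move/eqP; rewrite oner_eq0.
- apply/eqP; rewrite eqEsubv; apply/andP; split.
    apply/subv_sumP => i _; apply: cyclic_space_min => nu.
    have := UE i; rewrite !mem_mxKer => /eqP Ai0; apply/eqP.
    exact: expmx_cyclic_eq0 Ai0 (mem_cyclic_space _ _ _).
  apply/subvP => x; rewrite mem_mxKer => /eqP Ax0.
  (* A block with nonzero eigenvalue is invertible, so a vector killed by one of its powers is
     zero. *)
  have Cx0 j : a j != 0 -> C j *m x = 0.
    move=> /(jordan_block_unit (s j)) uJ.
    have : J j ^+ n'.+1 *m (C j *m x) = 0.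
      by rewrite mulmxA -CAX -mulmxA Ax0 mulmx0.
    move: (C j *m x) => y; elim: (n'.+1) => [|d IHd]; first by rewrite expr0 mul1mx.
    rewrite exprS -mulmxE -mulmxA => /(congr1 (mulmx (invmx (J j)))).
    by rewrite mulKmx // mulmx0.
  rewrite -[x]mul1mx -BC mulmx_suml.
  rewrite (bigID (fun j => a j == 0)) /= [X in _ + X]big1 => [|j nz]; last first.
    by rewrite -mulmxA Cx0 ?mulmx0.
  have -> (g : 'I_m -> 'cV[F]_n'.+1) : \sum_(j | a j == 0) g j = \sum_i g (f i).
    rewrite -[RHS]big_enum /= -(big_map f xpredT g) (perm_big _ permf).
    by rewrite big_filter big_enum_cond.
  by rewrite addr0; apply: memv_sumr => i _; rewrite -mulmxA BU.
apply/directv_sum_independent => w wU sum0 i _.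
have {wU}/fin_all_exists[y def_w] l : exists y, w l = B (f l) *m y.
  exact/cycU/wU.
(* Projecting onto block [f i] isolates the [i]-th term, since [f] is injective and distinct blocks
   are independent. *)
have := congr1 (mulmx (C (f i))) sum0.
rewrite mulmx0 mulmx_sumr (bigD1 i) //= big1 ?addr0 => [|l ne_l].
  by rewrite def_w C_B_inj => ->; rewrite mulmx0.
by rewrite def_w mulmxA CB submxblock1_neq ?mul0mx // (inj_eq f_inj) eq_sym.
Qed.

End Jordan.

Theorem theorem2p1 (R : realType) (n : nat) (A : 'M[R[i]]_n)
    (hA : eigenvalue A 0)
    (k : nat) (t : 'I_k -> nat)
    (ht_sorted : {homo t : i j / (i <= j)%N})
    (ht : elementary_divisors A 0 t)
    (r : 'I_k -> nat) (hr : forall i, (r i < t i)%N) :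
  ({homo r : i j / (i <= j)%N} /\
   {homo (fun i => t i - r i)%N : i j / (i <= j)%N}
   <->
   forall u u' : 'I_k -> 'cV[R[i]]_n,
     generators A t u -> generators A t u' -> WU A r u = WU A r u')
  /\
  ({homo r : i j / (i <= j)%N} /\
   {homo (fun i => t i - r i)%N : i j / (i <= j)%N} ->
   forall u : 'I_k -> 'cV[R[i]]_n, generators A t u -> WU A r u = W A t r).
Proof.
(* In dimension 0 there is no eigenvector; otherwise the size is a successor, as [horner_mx]
   requires. *)
case: n A hA ht => [|n] A hA ht.
  by case/eigenvalueP: hA => v _; rewrite (thinmx0 v) eqxx.
have eqW : {homo r : i j / (i <= j)%N} /\
    {homo (fun i => t i - r i)%N : i j / (i <= j)%N} ->
    forall u, generators A t u -> WU A r u = W A t r.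
  case=> rS trS u genU; apply/eqP; rewrite eqEsubv WU_sub_W //.
  exact: W_sub_WU.
split=> //; split=> [rtS u u' genU genU'|indep]; first by rewrite !eqW.
have [u genU] := exists_generators ht.
have bound i j d : i != j -> (t j <= d + t i)%N -> (r j <= r i + d)%N.
  move=> ne_ij le_t; apply: (WU_invariant_leq genU (hr j) ne_ij le_t).
  exact/indep/transvect_generators.
split=> i j; rewrite leq_eqVlt => /orP[/eqP/val_inj-> //|lt_ij].
  (* Here [u j] is the generator being changed, by adding [u i] itself. *)
  rewrite -[leqRHS]addn0; apply: bound; last exact/ht_sorted/ltnW.
  by rewrite -val_eqE gtn_eqF.
have le_t := ht_sorted _ _ (ltnW lt_ij).
(* Now [u i] is changed, with the least shift that preserves its exponent bound; the outcome
   [r j <= r i + (t j - t i)] rearranges to the second condition. *)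
have := bound i j (t j - t i)%N; rewrite subnK // leqnn -val_eqE ltn_eqF //.
by move=> /(_ isT isT) /=; have := hr i; have := hr j; lia.
Qed.
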